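(* Let $V_1,V_2,V_3$ be complex vector spaces of dimensions $d_1,d_2,d_3$, let $\mathcal R_d=\mathrm{Hom}(V_2,V_1)\oplus\mathrm{Hom}(V_2,V_3)$, and let $\overline{\mathcal O}_{k_1,k_2,q_1}\subset\mathcal R_d$ be the closure of the (nonempty) orbit of pairs $(\phi_{a_1},\phi_{a_2})$ with $\dim\ker\phi_{a_1}=k_1$, $\dim\ker\phi_{a_2}=k_2$, $\dim(\ker\phi_{a_1}\cap\ker\phi_{a_2})=q_1$. With the resolutions of type (i) and (ii) of $\overline{\mathcal O}_{k_1,k_2,q_1}$ described in the context: - the resolution of type (i) is crepant when $d_1=d_3=d_2-q_1$ and $k_1+k_2=d_2$; - the resolution of type (ii) is crepant when $q_1=k_1$, $d_1=k_2$ and $d_3=d_2-k_1$.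
   Context: The quiver is of type $A_3$ with vertices $s_1,s_2,s_3$ and arrows $a_1:s_2\to s_1$, $a_2:s_2\to s_3$; $\phi_{a_1}\in\mathrm{Hom}(V_2,V_1)$, $\phi_{a_2}\in\mathrm{Hom}(V_2,V_3)$, and the group acting on $\mathcal R_d$ is $\mathrm{GL}(V_1)\times\mathrm{GL}(V_2)\times\mathrm{GL}(V_3)$. Notation: $\mathrm{Gr}(k,V)$ is the Grassmannian of $k$-dimensional subspaces of $V$. On a Grassmannian of subspaces of $V_i$, $\mathcal U_i$ is the tautological subbundle and $\mathcal Q_i=V_i/\mathcal U_i$ the quotient bundle; these are pulled back to products. The resolution is the total space of a subbundle $W$ of the trivial bundle $\mathcal R_d\times F\to F$, together with the projection to $\mathcal R_d$: Type (i), used if $q_1\neq k_1,k_2$: $F=\mathrm{Gr}(d_2-k_1,V_1)\times\mathrm{Gr}(q_1,V_2)\times\mathrm{Gr}(d_2-k_2,V_3)$ and $W=\mathcal Q_2^*\otimes(\mathcal U_1\oplus\mathcal U_3)$. Type (ii), used if $q_1=k_1$: $F=\mathrm{Gr}(q_1,V_2)\times\mathrm{Gr}(d_2-k_2,V_3)$ and $W=\mathcal Q_2^*\otimes(V_1\oplus\mathcal U_3)$. Such a resolution is crepant if $\det(W)\cong K_F$ as line bundles on $F$ (equivalently, the total space of $W$ has trivial canonical bundle). *)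

(* Defs.v *)
From HB Require Import structures.
From mathcomp Require Import all_boot all_order all_algebra.
From mathcomp Require Import complex.
From mathcomp Require Import (canonicals) mpoly.
From mathcomp Require Import boolp classical_sets reals topology normedtype derive.

Set Implicit Arguments.
Unset Strict Implicit.
Unset Printing Implicit Defensive.

Import Order.TTheory GRing.Theory Num.Theory.
Import numFieldNormedType.Exports.
Local Open Scope classical_set_scope.
Local Open Scope ring_scope.

Section RegularFunctions.
Variable (C : numFieldType).

Definition regular_fun n (f : 'rV[C]_n -> C) : Prop :=
  exists p : mpoly.mpoly n C,
    forall u, f u = mpoly.meval (fun i => u 0 i) p.

Definition regular_vect n (E : vectType C) (f : 'rV[C]_n -> E) : Prop :=
  forall a, regular_fun (fun u => coord (vbasis {:E}) a (f u)).

Lemma regular_cst n c : regular_fun (fun _ : 'rV[C]_n => c).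
Proof. by exists (mpoly.mpolyC n c) => u; rewrite mpoly.mevalC. Qed.

Lemma regular_coord n i : regular_fun (fun u : 'rV[C]_n => u 0 i).
Proof.
by exists (mpoly.mpolyX C (mpoly.mnm1 i)) => u; rewrite mpoly.mevalXU.
Qed.

Lemma regularD n (f g : 'rV[C]_n -> C) :
  regular_fun f -> regular_fun g -> regular_fun (fun u => f u + g u).
Proof.
by move=> [p fE] [q gE]; exists (p + q) => u; rewrite fE gE mpoly.mevalD.
Qed.

Lemma regularM n (f g : 'rV[C]_n -> C) :
  regular_fun f -> regular_fun g -> regular_fun (fun u => f u * g u).
Proof.
by move=> [p fE] [q gE]; exists (p * q) => u; rewrite fE gE mpoly.mevalM.
Qed.

Lemma eq_regular n (f g : 'rV[C]_n -> C) : f =1 g -> regular_fun f -> regular_fun g.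
Proof. by move=> fg [p fE]; exists p => u; rewrite -fg. Qed.

Lemma regular_sum n (I : Type) (r : seq I) (F : I -> 'rV[C]_n -> C) :
  (forall i, regular_fun (F i)) -> regular_fun (fun u => \sum_(i <- r) F i u).
Proof.
move=> Freg; elim: r => [|i r IHr].
  by apply: eq_regular (regular_cst n 0) => u; rewrite big_nil.
by apply: eq_regular (regularD (Freg i) IHr) => u; rewrite big_cons.
Qed.

Lemma regular_prod n (I : Type) (r : seq I) (F : I -> 'rV[C]_n -> C) :
  (forall i, regular_fun (F i)) -> regular_fun (fun u => \prod_(i <- r) F i u).
Proof.
move=> Freg; elim: r => [|i r IHr].
  by apply: eq_regular (regular_cst n 1) => u; rewrite big_nil.
by apply: eq_regular (regularM (Freg i) IHr) => u; rewrite big_cons.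
Qed.

Lemma regular_det n m (M : 'rV[C]_n -> 'M[C]_m) :
  (forall i j, regular_fun (fun u => M u i j)) -> regular_fun (fun u => \det (M u)).
Proof.
move=> Mreg; rewrite /determinant; apply: regular_sum => s.
by apply: regularM; [exact: regular_cst | apply: regular_prod].
Qed.

Lemma regular_adj n m (M : 'rV[C]_n -> 'M[C]_m) i j :
  (forall i j, regular_fun (fun u => M u i j)) -> regular_fun (fun u => \adj (M u) i j).
Proof.
move=> Mreg; apply: (@eq_regular _ (fun u => cofactor (M u) j i)).
  by move=> u; rewrite mxE.
apply: regularM; first exact: regular_cst.
apply: regular_det => k l.
by apply: eq_regular (Mreg (lift j k) (lift i l)) => u; rewrite !mxE.
Qed.

Lemma regular_sub n m (s : 'I_n -> 'I_m) (f : 'rV[C]_n -> C)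
    (g : 'rV[C]_m -> 'rV[C]_n) :
  (forall u i, g u 0 i = u 0 (s i)) -> regular_fun f -> regular_fun (fun u => f (g u)).
Proof.
move=> gE [p fE].
exists (mpoly.comp_mpoly [tuple mpoly.mpolyX C (mpoly.mnm1 (s i)) | i < n] p).
move=> u; rewrite mpoly.comp_mpoly_meval fE; apply: mpoly.meval_eq => i.
by rewrite tnth_mktuple mpoly.mevalXU.
Qed.

End RegularFunctions.

Section Varieties.
Variable (C : numFieldType).

(* A smooth variety glued from affine spaces: every overlap is a principal
   open subset {D != 0} of the affine space on which the change of coordinates
   is rational (separatedness is not imposed).  The set of closed points is
   [carrier], a subset of an ambient type *)
Record variety := Variety {
  vpoint :> Type;
  carrier : set vpoint;
  vdim : nat;
  chart_index : Type;
  chart : chart_index -> 'rV[C]_vdim -> vpoint;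
  carrierE : carrier = \bigcup_i range (chart i);
  chart_inj : forall i, injective (chart i);
  chart_rational : forall i j,
    exists (D : 'rV[C]_vdim -> C) (N : 'I_vdim -> 'rV[C]_vdim -> C),
      [/\ regular_fun D, forall k, regular_fun (N k),
          forall u, range (chart j) (chart i u) <-> D u != 0 &
          forall u v, chart i u = chart j v ->
            forall k, v 0 k = N k u / D u] }.

Definition transition (X : variety) (i j : chart_index X)
    (u : 'rV[C]_(vdim X)) : 'rV[C]_(vdim X) :=
  xget 0 [set v | chart j v = chart i u].

(* A line bundle on X that is trivial on each chart is given by the functions
   g i j such that e_j = g i j * e_i on the overlap of the charts i and j,
   where e_i is the given local generator over the chart i; [g i j] is a
   function of the coordinates in the chart i and only its values on the
   overlap are meaningful *)
Definition cocycle (X : variety) :=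
  chart_index X -> chart_index X -> 'rV[C]_(vdim X) -> C.

(* The isomorphism sends the local generator e_i to h i * e'_i *)
Definition line_bundle_iso (X : variety) (g g' : cocycle X) : Prop :=
  exists h : chart_index X -> 'rV[C]_(vdim X) -> C,
    [/\ forall i, regular_fun (h i),
        forall i u, h i u != 0 &
        forall i j u v, chart i u = chart j v ->
          g i j u * h i u = h j v * g' i j u].

(* K_X, with local generators du_1 /\ ... /\ du_n *)
Definition canonical_bundle (X : variety) : cocycle X :=
  fun i j u => \det (jacobian (transition i j) u).
Arguments canonical_bundle : clear implicits.

Definition local_frames (X : variety) (E : vectType C) (W : X -> set E)
    (r : nat) (s : chart_index X -> 'rV[C]_(vdim X) -> r.-tuple E) : Prop :=
  forall i,
    (forall a, regular_vect (fun u => tnth (s i u) a)) /\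
    (forall u, free (s i u) /\ W (chart i u) = [set` <<s i u>>%VS]).

(* det W, with local generators s_1 /\ ... /\ s_r *)
Definition det_bundle (X : variety) (E : vectType C) (r : nat)
    (s : chart_index X -> 'rV[C]_(vdim X) -> r.-tuple E) : cocycle X :=
  fun i j u =>
    \det (\matrix_(a, b) coord (s i u) b (tnth (s j (transition i j u)) a)).

(* A subbundle W of the trivial bundle E x F over F = res_base; it stands for
   its total space {(e, x) | W x e} together with the projection to E *)
Record resolution (E : vectType C) := Resolution {
  res_base : variety;
  res_bundle : res_base -> set E }.

(* W is an algebraic vector bundle and det W is isomorphic to K_F; the
   isomorphism class of det W does not depend on the local frames of W that
   describe it *)
Definition crepant (E : vectType C) (Z : resolution E) : Prop :=
  exists r
    (s : chart_index (res_base Z) -> 'rV[C]_(vdim (res_base Z)) -> r.-tuple E),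
    local_frames (@res_bundle _ Z) s /\
    line_bundle_iso (det_bundle s) (canonical_bundle (res_base Z)).

End Varieties.
Arguments carrier {C} X : rename.
Arguments canonical_bundle {C} X.
Arguments Variety {C vpoint carrier vdim chart_index chart}.
Arguments Resolution {C E} res_base res_bundle.

Section Product.
Variables (C : numFieldType) (X Y : variety C).

Definition prod_chart (ij : chart_index X * chart_index Y)
    (u : 'rV[C]_(vdim X + vdim Y)) : X * Y :=
  (chart ij.1 (lsubmx u), chart ij.2 (rsubmx u)).

Lemma prod_carrierE :
  carrier X `*` carrier Y = \bigcup_i range (prod_chart i).
Proof.
rewrite !carrierE; apply/seteqP; split=> [[x y] [/= [i _ [u _ <-]] [j _ [v _ <-]]]|].
  exists (i, j) => //; exists (row_mx u v) => //.
  by rewrite /prod_chart row_mxKl row_mxKr.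
by move=> _ [[i j] _ [u _ <-]]; split; [exists i | exists j] => //; eexists.
Qed.

Lemma prod_chart_inj i : injective (prod_chart i).
Proof.
move=> u v [/chart_inj uvl /chart_inj uvr].
by rewrite -[u]hsubmxK -[v]hsubmxK uvl uvr.
Qed.

Lemma prod_chart_rational i j :
  exists (D : 'rV[C]_(vdim X + vdim Y) -> C)
         (N : 'I_(vdim X + vdim Y) -> 'rV[C]_(vdim X + vdim Y) -> C),
    [/\ regular_fun D, forall k, regular_fun (N k),
        forall u, range (prod_chart j) (prod_chart i u) <-> D u != 0 &
        forall u v, prod_chart i u = prod_chart j v ->
          forall k, v 0 k = N k u / D u].
Proof.
have [D1 [N1 [D1r N1r D1E N1E]]] := chart_rational i.1 j.1.
have [D2 [N2 [D2r N2r D2E N2E]]] := chart_rational i.2 j.2.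
have lr (f : 'rV[C]_(vdim X) -> C) : regular_fun f ->
    regular_fun (fun u : 'rV_(vdim X + vdim Y) => f (lsubmx u)).
  by apply: (@regular_sub _ _ _ (lshift _)) => u k; rewrite mxE.
have rr (f : 'rV[C]_(vdim Y) -> C) : regular_fun f ->
    regular_fun (fun u : 'rV_(vdim X + vdim Y) => f (rsubmx u)).
  by apply: (@regular_sub _ _ _ (@rshift _ _)) => u k; rewrite mxE.
have DE u : range (prod_chart j) (prod_chart i u) <->
    D1 (lsubmx u) * D2 (rsubmx u) != 0.
  rewrite mulf_eq0 negb_or; split=> [[v _ [/esym e1 /esym e2]]|/andP[]].
    by apply/andP; split; [apply/D1E; rewrite e1 | apply/D2E; rewrite e2].
  move=> /D1E[v _ e1] /D2E[w _ e2]; exists (row_mx v w) => //.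
  by rewrite /prod_chart row_mxKl row_mxKr e1 e2.
exists (fun u => D1 (lsubmx u) * D2 (rsubmx u)),
  (fun k u => match split k with
              | inl a => N1 a (lsubmx u) * D2 (rsubmx u)
              | inr b => D1 (lsubmx u) * N2 b (rsubmx u)
              end); split=> //.
- by apply: regularM; [apply: lr | apply: rr].
- by move=> k; case: (split k) => a; apply: regularM; (apply: lr || apply: rr).
- move=> u v e k; have /DE : range (prod_chart j) (prod_chart i u) by exists v.
  rewrite mulf_eq0 negb_or => /andP[D1u D2u]; case: e => e1 e2.
  case: splitP => a ka.
    rewrite (_ : k = lshift _ a); last exact: val_inj.
    by rewrite -mulf_div divff // mulr1 -(N1E _ _ e1) mxE.
  rewrite (_ : k = rshift _ a); last exact: val_inj.
  by rewrite -mulf_div divff // mul1r -(N2E _ _ e2) mxE.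
Qed.

Definition prod_variety : variety C :=
  Variety prod_carrierE prod_chart_inj prod_chart_rational.

End Product.

Section Grassmannian.
Variables (C : numFieldType) (V : vectType C) (k : nat).

Local Notation m := (\dim {:V} - k)%N.

Definition gr_index :=
  {bc : k.-tuple V * m.-tuple V | basis_of {:V} (bc.1 ++ bc.2)}.

(* The chart of a basis b ++ c of V sends a matrix A to the graph of the map
   b_i |-> \sum_j A i j *: c_j from <<b>> to <<c>> *)
Definition gr_frame (bc : gr_index) (A : 'M[C]_(k, m)) : k.-tuple V :=
  [tuple tnth (val bc).1 i + \sum_j A i j *: tnth (val bc).2 j | i < k].

Definition gr_chart (bc : gr_index) (u : 'rV[C]_(k * m)) : {vspace V} :=
  <<gr_frame bc (vec_mx u)>>%VS.

Definition gr_basis (bc : gr_index) : (k + m).-tuple V :=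
  cat_tuple (val bc).1 (val bc).2.
Definition gr_cb bc l (x : V) := coord (gr_basis bc) (lshift m l) x.
Definition gr_cc bc j (x : V) := coord (gr_basis bc) (rshift k j) x.

Lemma gr_basisP bc : basis_of {:V} (gr_basis bc).
Proof. exact: (valP bc). Qed.

Lemma gr_basisl bc l : (gr_basis bc)`_(lshift m l) = tnth (val bc).1 l.
Proof. by rewrite /= nth_cat size_tuple /= ltn_ord -tnth_nth. Qed.

Lemma gr_basisr bc j : (gr_basis bc)`_(rshift k j) = tnth (val bc).2 j.
Proof.
by rewrite /= nth_cat size_tuple /= ltnNge leq_addr /= addKn -tnth_nth.
Qed.

Lemma gr_coordE bc x :
  x = \sum_l gr_cb bc l x *: tnth (val bc).1 l
      + \sum_j gr_cc bc j x *: tnth (val bc).2 j.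
Proof.
rewrite {1}(coord_basis (gr_basisP bc) (memvf x)) big_split_ord /=.
by congr (_ + _); apply: eq_bigr => i _; rewrite -?gr_basisl -?gr_basisr.
Qed.

Lemma gr_row bc A i : tnth (gr_frame bc A) i =
  tnth (val bc).1 i + \sum_j A i j *: tnth (val bc).2 j.
Proof. by rewrite tnth_mktuple. Qed.

Lemma gr_cb_row bc A i l : gr_cb bc l (tnth (gr_frame bc A) i) = (i == l)%:R.
Proof.
rewrite gr_row /gr_cb linearD linear_sum /= -gr_basisl.
rewrite coord_free ?(basis_free (gr_basisP bc)) // eq_lshift.
rewrite big1 ?addr0 // => j _; rewrite linearZ /= -gr_basisr.
by rewrite coord_free ?(basis_free (gr_basisP bc)) // eq_rlshift mulr0.
Qed.

Lemma gr_cc_row bc A i j : gr_cc bc j (tnth (gr_frame bc A) i) = A i j.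
Proof.
rewrite gr_row /gr_cc linearD linear_sum /= -gr_basisl.
rewrite coord_free ?(basis_free (gr_basisP bc)) // eq_lrshift add0r.
rewrite (bigD1 j) //= linearZ /= -gr_basisr.
rewrite coord_free ?(basis_free (gr_basisP bc)) // eqxx mulr1.
rewrite big1 ?addr0 // => l lj; rewrite linearZ /= -gr_basisr.
rewrite coord_free ?(basis_free (gr_basisP bc)) // eq_rshift.
by rewrite (negPf lj) mulr0.
Qed.

Lemma gr_cb_comb bc A (z : 'I_k -> C) l :
  gr_cb bc l (\sum_i z i *: tnth (gr_frame bc A) i) = z l.
Proof.
rewrite /gr_cb linear_sum (eq_bigr (fun i => z i * (i == l)%:R)); last first.
  by move=> i _; rewrite -(gr_cb_row bc A) linearZ.
by rewrite (bigD1 l) //= eqxx mulr1 big1 ?addr0 // => i /negPf->; rewrite mulr0.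
Qed.

Lemma gr_cc_comb bc A (z : 'I_k -> C) j :
  gr_cc bc j (\sum_i z i *: tnth (gr_frame bc A) i) = \sum_i z i * A i j.
Proof.
rewrite /gr_cc linear_sum; apply: eq_bigr => i _.
by rewrite -(gr_cc_row bc A) linearZ.
Qed.

Lemma gr_mem bc A x :
  x \in <<gr_frame bc A>>%VS <->
  forall j, gr_cc bc j x = \sum_l gr_cb bc l x * A l j.
Proof.
split=> [/coord_span + j|xE].
  under eq_bigr do rewrite -tnth_nth.
  move=> ->; rewrite gr_cc_comb; apply: eq_bigr => i _.
  by rewrite gr_cb_comb.
rewrite (_ : x = \sum_l gr_cb bc l x *: tnth (gr_frame bc A) l).
  by apply: rpred_sum => l _; apply/rpredZ/memv_span/mem_tnth.
rewrite {1}(gr_coordE bc x).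
under [in RHS]eq_bigr do rewrite gr_row scalerDr scaler_sumr.
rewrite big_split /=; congr (_ + _).
rewrite exchange_big /=; apply: eq_bigr => j _.
by rewrite xE scaler_suml; apply: eq_bigr => l _; rewrite scalerA.
Qed.

Lemma gr_free bc A : free (gr_frame bc A).
Proof.
apply/freeP => z + i; under eq_bigr do rewrite -tnth_nth.
by move=> /(congr1 (gr_cb bc i)); rewrite gr_cb_comb /gr_cb linear0.
Qed.

Lemma gr_dim bc A : \dim <<gr_frame bc A>> = k.
Proof. by have := gr_free bc A; rewrite /free size_tuple => /eqP. Qed.

Lemma gr_mx_inj bc A B :
  <<gr_frame bc A>>%VS = <<gr_frame bc B>>%VS -> A = B.
Proof.
move=> AB; apply/matrixP => i j.
have: tnth (gr_frame bc A) i \in <<gr_frame bc B>>%VS.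
  by rewrite -AB; apply/memv_span/mem_tnth.
move=> /gr_mem/(_ j); rewrite gr_cc_row => ->.
rewrite (bigD1 i) //= gr_cb_row eqxx mul1r big1 ?addr0 // => l li.
by rewrite gr_cb_row eq_sym (negPf li) mul0r.
Qed.

Lemma gr_chart_inj bc : injective (gr_chart bc).
Proof. by move=> u v /gr_mx_inj/(can_inj vec_mxK). Qed.

Lemma gr_carrierE :
  [set U : {vspace V} | \dim U = k] = \bigcup_i range (gr_chart i).
Proof.
apply/seteqP; split=> [U /= dU|_ [bc _ [u _ <-]] /=]; last exact: gr_dim.
have dC : \dim U^C = m by rewrite dimv_compl dU.
have bcP : basis_of {:V} (tcast dU (vbasis U) ++ tcast dC (vbasis U^C)).
  rewrite !val_tcast /= -(addv_complf U); apply: cat_basis; try exact: vbasisP.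
  exact/directv_addP/capv_compl.
exists (exist _ (tcast dU (vbasis U), tcast dC (vbasis U^C)) bcP) => //.
exists 0 => //; rewrite /gr_chart -[RHS](span_basis (vbasisP U)).
congr span; rewrite -(val_tcast dU); congr val; apply: eq_from_tnth => i.
rewrite gr_row /= big1 ?addr0 // => j _.
by rewrite !mxE scale0r.
Qed.

Lemma gr_chart_rational bc bc' :
  exists (D : 'rV[C]_(k * m) -> C) (N : 'I_(k * m) -> 'rV[C]_(k * m) -> C),
    [/\ regular_fun D, forall a, regular_fun (N a),
        forall u, range (gr_chart bc') (gr_chart bc u) <-> D u != 0 &
        forall u v, gr_chart bc u = gr_chart bc' v ->
          forall a, v 0 a = N a u / D u].
Proof.
pose r (u : 'rV[C]_(k * m)) i := tnth (gr_frame bc (vec_mx u)) i.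
pose P u := \matrix_(i, l) gr_cb bc' l (r u i).
pose Q u := \matrix_(i, j) gr_cc bc' j (r u i).
have rreg (f : {scalar V}) i : regular_fun (fun u => f (r u i)).
  apply: (@eq_regular _ _ (fun u => f (tnth (val bc).1 i) +
      \sum_j u 0 (mxvec_index i j) * f (tnth (val bc).2 j))) => [u|].
    rewrite /r gr_row linearD linear_sum; congr (_ + _).
    by apply: eq_bigr => j _; rewrite linearZ /= mxE.
  apply: regularD; first exact: regular_cst.
  by apply: regular_sum => j; apply: regularM;
    [exact: regular_coord | exact: regular_cst].
have Preg i l : regular_fun (fun u => P u i l).
  by apply: eq_regular (rreg (coord (gr_basis bc') (lshift m l)) i) => u;
    rewrite mxE.
have Qreg i j : regular_fun (fun u => Q u i j).
  by apply: eq_regular (rreg (coord (gr_basis bc') (rshift k j)) i) => u;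
    rewrite mxE.
have eqPQ u v : gr_chart bc u = gr_chart bc' v -> Q u = P u *m vec_mx v.
  move=> e; apply/matrixP => i j; rewrite !mxE.
  have: r u i \in gr_chart bc' v by rewrite -e; apply/memv_span/mem_tnth.
  by move=> /gr_mem->; apply: eq_bigr => l _; rewrite !mxE.
have unitP u v : gr_chart bc u = gr_chart bc' v -> P u \in unitmx.
  move=> e; pose r' := tnth (gr_frame bc' (vec_mx v)).
  pose M := \matrix_(l, i) coord (gr_frame bc (vec_mx u)) i (r' l).
  suff: M *m P u = 1%:M by move=> /mulmx1_unit[].
  apply/matrixP => l l'; rewrite !mxE -(gr_cb_row bc' (vec_mx v)) -/(r' l).
  have: r' l \in gr_chart bc u by rewrite e; apply/memv_span/mem_tnth.
  move=> /coord_span; under eq_bigr do rewrite -tnth_nth.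
  rewrite -/(r' l) => r'E; rewrite [in RHS]r'E /gr_cb linear_sum.
  by apply: eq_bigr => i _; rewrite linearZ !mxE.
exists (fun u => \det (P u)),
  (fun a u => mxvec (\adj (P u) *m Q u) 0 a); split.
- exact: regular_det.
- move=> a; case/mxvec_indexP: a => i j.
  apply: (@eq_regular _ _ (fun u => \sum_l \adj (P u) i l * Q u l j)) => [u|].
    by rewrite mxvecE mxE.
  by apply: regular_sum => l; apply: regularM => //; exact: regular_adj.
- move=> u; split=> [[v _ /esym /unitP]|]; first by rewrite unitmxE unitfE.
  rewrite -unitfE -unitmxE => Pu.
  exists (mxvec (invmx (P u) *m Q u)) => //; apply/esym/eqP.
  rewrite /gr_chart mxvecK eqEdim !gr_dim leqnn andbT.
  apply/span_subvP => _ /tnthP[i ->]; apply/gr_mem => j.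
  rewrite -/(r u i) -[LHS](mxE matrix_key (fun i j => gr_cc bc' j (r u i))).
  rewrite -/(Q u) -[in LHS](mulKVmx Pu (Q u)) mxE.
  by apply: eq_bigr => l _; rewrite !mxE.
- move=> u v e a; have Pu := unitP _ _ e.
  rewrite -[v in LHS]vec_mxK -(mulKmx Pu (vec_mx v)) -(eqPQ _ _ e) /invmx Pu.
  by rewrite -scalemxAl linearZ !mxE mulrC.
Qed.

Definition Gr : variety C :=
  Variety gr_carrierE gr_chart_inj gr_chart_rational.

End Grassmannian.

Section Quiver.
Variables (C : numFieldType) (V1 V2 V3 : vectType C).

Definition rep : vectType C := ('Hom(V2, V1) * 'Hom(V2, V3))%type.

Definition quiver_orbit (k1 k2 q1 : nat) : set rep :=
  [set phi | [/\ \dim (lker phi.1) = k1, \dim (lker phi.2) = k2 &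
                 \dim (lker phi.1 :&: lker phi.2) = q1]].

(* The fibre Q_2^* (x) (U_1 (+) U_3) = Hom(V_2 / U_2, U_1) (+) Hom(V_2 / U_2, U_3)
   consists of the pairs of maps that vanish on U_2 and take their values in
   U_1 and U_3 *)
Definition resolution_i (k1 k2 q1 : nat) : resolution rep :=
  let d2 := \dim {:V2} in
  let F := prod_variety
             (prod_variety (Gr V1 (d2 - k1)) (Gr V2 q1)) (Gr V3 (d2 - k2)) in
  Resolution F (fun '(U1, U2, U3) =>
    [set phi : rep | [/\ (U2 <= lker phi.1)%VS, (U2 <= lker phi.2)%VS,
                         (limg phi.1 <= U1)%VS & (limg phi.2 <= U3)%VS]]).

Definition resolution_ii (k2 q1 : nat) : resolution rep :=
  let d2 := \dim {:V2} in
  let F := prod_variety (Gr V2 q1) (Gr V3 (d2 - k2)) in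
  Resolution F (fun '(U2, U3) =>
    [set phi : rep | [/\ (U2 <= lker phi.1)%VS, (U2 <= lker phi.2)%VS &
                         (limg phi.2 <= U3)%VS]]).

End Quiver.
Arguments quiver_orbit {C} V1 V2 V3 k1 k2 q1.
Arguments resolution_i {C} V1 V2 V3 k1 k2 q1.
Arguments resolution_ii {C} V1 V2 V3 k2 q1.

(* Main.v *)
Require Import Defs.
From HB Require Import structures.
From mathcomp Require Import all_boot all_order all_algebra.
From mathcomp Require Import complex.
From mathcomp Require Import (canonicals) mpoly.
From mathcomp Require Import ring interval_inference.
From mathcomp Require Import boolp classical_sets reals topology normedtype.
From mathcomp Require Import landau derive.

Set Implicit Arguments.
Unset Strict Implicit.
Unset Printing Implicit Defensive.

Import Order.TTheory GRing.Theory Num.Theory.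
Import numFieldNormedType.Exports.
Local Open Scope classical_set_scope.
Local Open Scope ring_scope.

(* In two charts of Gr(k, V), given by the bases (b, c) and (b', c'), let P be
   the transition matrix of the tautological bundle U and S that of the
   quotient bundle V/U.  Points with coordinates A, B in the first chart and
   A', B' in the second satisfy P(B) (B' - A') = (B - A) S(A') exactly, so that
   the Jacobian of the transition is X |-> P^-1 X S, of determinant
   (det P)^-(dim V - k) (det S)^k.  Since det P det S is the constant
   det(b, c) / det(b', c'), K is isomorphic to (det U)^(dim V) and to
   (det V/U)^-(dim V), by isomorphisms that are constant in each chart.
   On the other hand det (Q_2^* (x) U_1) has the cocycle
   (det S_2)^(rk U_1) (det P_1)^-(rk Q_2).  The numerical hypotheses make all
   exponents agree, and the function h of [line_bundle_iso] is then a monomial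
   in the determinants of the bases that define the charts. *)

(** * Determinant of X |-> A X B *)

Section Determinants.
Variable F : fieldType.

(** Injectivity and equality of dimensions make [T] invertible, so [M] and [N] are conjugate. The
    sizes are equated by a hypothesis because [m * n.+1] and [m + m * n] are not convertible. *)
Lemma det_intertwine p q (M : 'M[F]_p) (N : 'M[F]_q) (T : 'M[F]_(p, q)) :
  p = q -> (forall v : 'rV_p, v *m T = 0 -> v = 0) -> M *m T = T *m N ->
  \det M = \det N.
Proof.
move=> epq; move: N T; rewrite -epq => N T Tinj MT.
have Tu : T \in unitmx by rewrite -row_free_unit; exact: inj_row_free.
rewrite -[M](mulmxK Tu) MT !det_mulmx det_inv mulrC mulKf //.
by rewrite -unitfE -unitmxE.
Qed.

(** Induction on the rows of X: [T] splits off the first row, on which the map is [B], from the m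
    remaining rows. *)
Lemma det_lin_mulmxr m n (B : 'M[F]_n) :
  \det (lin_mulmxr B : 'M_(m * n)) = \det B ^+ m.
Proof.
elim: m => [|m IHm]; first by rewrite det_mx00 expr0.
pose T : 'M[F]_(m.+1 * n, n + m * n) :=
  row_mx (lin1_mx (usubmx \o @vec_mx F (1 + m) n))
         (lin1_mx (mxvec \o dsubmx \o @vec_mx F (1 + m) n)).
rewrite exprS -IHm -(det_ublock B 0).
apply: (@det_intertwine _ _ _ _ T) => [//|v|].
  rewrite mul_mx_row !mul_rV_lin1 /= => v0.
  apply: (can_inj (@vec_mxK _ _ _)); rewrite linear0.
  rewrite -[vec_mx v](@vsubmxK _ 1 m).
  move: v0 => /[dup] /(congr1 lsubmx) + /(congr1 (vec_mx \o rsubmx)) /=.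
  by rewrite row_mxKl row_mxKr mxvecK !linear0 => -> ->; rewrite col_mx0.
apply/row_matrixP => i; rewrite !rowE !mulmxA; move: (delta_mx _ _) => v.
rewrite !mul_mx_row !mul_rV_lin1 mul_row_block !mulmx0 addr0 add0r.
by rewrite !mul_rV_lin /= !mxvecK !mul_usub_mx !mul_dsub_mx.
Qed.

(** The same induction on columns. The first column, transposed to a row vector, is acted on by
    [A^T], hence the use of [det_tr]. *)
Lemma det_lin_mulmx m n (A : 'M[F]_m) :
  \det (lin_mulmx A : 'M_(m * n)) = \det A ^+ n.
Proof.
elim: n => [|n IHn].
  by move: (lin_mulmx _); rewrite muln0 => M; rewrite det_mx00 expr0.
pose T : 'M[F]_(m * n.+1, m + m * n) :=
  row_mx (lin1_mx (trmx \o lsubmx \o @vec_mx F m (1 + n)))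
         (lin1_mx (mxvec \o rsubmx \o @vec_mx F m (1 + n))).
rewrite exprS -IHn -[\det A]det_tr -(det_ublock A^T 0).
apply: (@det_intertwine _ _ _ _ T) => [|v|]; first by rewrite mulnS.
  rewrite mul_mx_row !mul_rV_lin1 /= => v0.
  apply: (can_inj (@vec_mxK _ _ _)); rewrite linear0.
  rewrite -[vec_mx v](@hsubmxK _ _ 1 n).
  move: v0 => /[dup] /(congr1 lsubmx) + /(congr1 (vec_mx \o rsubmx)) /=.
  rewrite row_mxKl row_mxKr mxvecK linear0 => lv ->.
  by rewrite -[lsubmx _]trmxK lv !linear0 row_mx0.
apply/row_matrixP => i; rewrite !rowE !mulmxA; move: (delta_mx _ _) => v.
rewrite !mul_mx_row !mul_rV_lin1 mul_row_block !mulmx0 addr0 add0r.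
by rewrite !mul_rV_lin /= !mxvecK -trmx_mul !mulmx_lsub !mulmx_rsub.
Qed.

End Determinants.

(** * Jacobians and transition maps *)

Section Jacobian.
Variable C : numFieldType.

Lemma ler_mx_norm m n (M : 'M[C]_(m, n)) (e : C) :
  0 <= e -> (forall i j, `|M i j| <= e) -> `|M| <= e.
Proof.
move=> e0 Me; rewrite /Num.norm /=.
have [->//|M0] := eqVneq (mx_norm M) 0.
by have [i ->] := mx_norm_neq0 M0.
Qed.

Lemma ler_norm_mx m n (M : 'M[C]_(m, n)) i j : `|M i j| <= `|M|.
Proof.
rewrite [leRHS]/Num.norm /= mx_normE -[leLHS]nngE num_le.
exact: (le_bigmax _ (fun ij : 'I_m * 'I_n => `|M ij.1 ij.2|%:nng) (i, j)).
Qed.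

Lemma ler_norm_mulmx n p (x : 'rV[C]_n) (A : 'M[C]_(n, p)) :
  `|x *m A| <= (\sum_i \sum_j `|A i j|) * `|x|.
Proof.
apply: ler_mx_norm => [|a b].
  by apply: mulr_ge0 => //; apply: sumr_ge0 => i _; apply: sumr_ge0.
rewrite mxE (le_trans (ler_norm_sum _ _ _)) // mulr_suml ler_sum // => i _.
rewrite normrM mulrC ler_pM ?ler_norm_mx //.
by rewrite (bigD1 b) //= lerDl sumr_ge0.
Qed.

Lemma mulmxr_continuous n p (A : 'M[C]_(n, p)) :
  continuous (mulmxr A : 'rV[C]_n -> 'rV[C]_p).
Proof.
apply/linear_bounded_continuous/linear_boundedP; near=> r => x.
rewrite (le_trans (ler_norm_mulmx _ _)) // ler_wpM2r //.
near: r; apply: nbhs_pinfty_ge; rewrite ger0_real //.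
by apply: sumr_ge0 => i _; apply: sumr_ge0.
Unshelve. all: by end_near. Qed.

Lemma cvg_sum n (u : 'rV[C]_n) (I : finType) (g : I -> 'rV[C]_n -> C)
    (a : I -> C) :
  (forall i, g i x @[x --> u] --> a i) ->
  \sum_i g i x @[x --> u] --> \sum_i a i.
Proof.
move=> ga.
have addc : continuous (fun x : C * C => x.1 + x.2).
  by move=> x; apply: cvgD; [exact: cvg_fst | exact: cvg_snd].
apply: (@cvg_big _ _ _ _ xpredT addc _ (nbhs u) _ _ _ (nbhs_filter u)) => i _.
exact: ga.
Qed.

(* Carathéodory's characterisation of the derivative: the slope L is
   continuous at u, so that L u is the Jacobian matrix *)
Lemma jacobian_caratheodory n p (f : 'rV[C]_n -> 'rV[C]_p)
    (L : 'rV[C]_n -> 'M[C]_(n, p)) (u : 'rV[C]_n) :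
  (forall i j, L x i j @[x --> u] --> L u i j) ->
  (\forall x \near u, f x - f u = (x - u) *m L x) ->
  jacobian f u = L u.
Proof.
move=> Lc fL.
suff df : 'd f u = mulmxr (L u) :> (_ -> _).
  rewrite /jacobian; apply/row_matrixP => i.
  by rewrite !rowE mul_rV_lin1 df.
apply: diff_unique; first exact: mulmxr_continuous.
apply/eqaddoP => e e0.
have Lij i j : `|(L x - L u) i j| @[x --> u] --> (0 : C).
  have : L x i j - L u i j @[x --> u] --> L u i j - L u i j.
    exact: (cvgB (Lc i j) (cvg_cst _)).
  rewrite subrr => /cvg_norm; rewrite normr0 => h.
  by under eq_fun do rewrite !mxE.
(* Near u the remainder is [(x - u) *m (L x - L u)], of norm at most this sum times [|x - u|]. *)
have Le : \forall x \near u, \sum_i \sum_j `|(L x - L u) i j| <= e.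
  have : (fun x => \sum_i \sum_j `|(L x - L u) i j|) x @[x --> u] --> (0 : C).
    have := cvg_sum (fun i => cvg_sum (Lij i)).
    by rewrite big1 // => i _; rewrite big1.
  move=> /cvgr0_norm_le/(_ e e0); apply: filterS => x.
  by rewrite ger0_norm // sumr_ge0 // => i _; rewrite sumr_ge0.
have ux : \forall x \near u, `|f x - f u - (x - u) *m L u| <= e * `|x - u|.
  near=> x; rewrite (near fL x) // -mulmxBr.
  by rewrite (le_trans (ler_norm_mulmx _ _)) // ler_wpM2r // (near Le x).
move: ux; rewrite (near_shift 0) subr0; apply: filterS => h /=.
by rewrite addrK -addrA -opprD.
Unshelve. all: by end_near. Qed.

(** Induction on the terms of the polynomial; a monomial is a finite product of powers of
    coordinates. *)
Lemma regular_continuous n (f : 'rV[C]_n -> C) (u : 'rV[C]_n) :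
  regular_fun f -> f x @[x --> u] --> f u.
Proof.
case=> p /funext->.
elim/mpoly.mpolyind: p => [|c m p _ _ IHp].
  under eq_fun do rewrite mpoly.meval0.
  rewrite mpoly.meval0.
  exact: (@cvg_cst C 0 _ (nbhs u) _).
have Xc :
    mpoly.meval (fun i => (x : 'rV[C]_n) 0 i) (mpoly.mpolyX C m) @[x --> u]
    --> mpoly.meval (fun i => u 0 i) (mpoly.mpolyX C m).
  under eq_fun do rewrite mpoly.mevalX.
  rewrite mpoly.mevalX.
  pose xm i (x : 'rV[C]_n) := x 0 i ^+ mpoly.fun_of_multinom m i.
  have mulc : continuous (fun x : C * C => x.1 * x.2).
    by move=> x; apply: cvgM; [exact: cvg_fst | exact: cvg_snd].
  have xmc i : xm i x @[x --> u] --> xm i u.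
    rewrite /xm; elim: (mpoly.fun_of_multinom m i) => [|k IHk].
      by under eq_fun do rewrite expr0; exact: (@cvg_cst C 1 _ (nbhs u) _).
    under eq_fun do rewrite exprS; rewrite exprS.
    exact: (cvgM (@coord_continuous C 1 n 0 i u) IHk).
  apply: (@cvg_big _ _ _ _ xpredT mulc _ (nbhs u) _ _ _ (nbhs_filter u)).
  by move=> i _; exact: xmc.
under eq_fun do rewrite mpoly.mevalD mpoly.mevalZ.
rewrite mpoly.mevalD mpoly.mevalZ.
exact: (cvgD (cvgM (cvg_cst c) Xc) IHp).
Qed.

End Jacobian.

(** * Slopes and their behaviour under products *)

Section Slopes.
Variable C : numFieldType.

(** A slope is required rather than mere differentiability: slopes assemble by blocks in a product,
    and [jacobian_caratheodory] reads the Jacobian off them. *)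
Definition has_slope n p (f : 'rV[C]_n -> 'rV[C]_p) u (M : 'M[C]_(n, p)) :=
  exists L : 'rV[C]_n -> 'M[C]_(n, p),
    [/\ L u = M, forall i j, L x i j @[x --> u] --> L u i j &
        \forall x \near u, f x - f u = (x - u) *m L x].

Lemma has_slope_jacobian n p (f : 'rV[C]_n -> 'rV[C]_p) u M :
  has_slope f u M -> jacobian f u = M.
Proof. by case=> L [<- Lc fL]; exact: jacobian_caratheodory. Qed.

Lemma lsubmx_continuous n p : continuous (@lsubmx C 1 n p).
Proof.
move=> u; rewrite (_ : lsubmx = mulmxr (col_mx 1%:M 0)).
  exact: mulmxr_continuous.
apply/funext => x /=.
by rewrite -{2}[x]hsubmxK mul_row_col mulmx1 mulmx0 addr0.
Qed.

Lemma rsubmx_continuous n p : continuous (@rsubmx C 1 n p).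
Proof.
move=> u; rewrite (_ : rsubmx = mulmxr (col_mx 0 1%:M)).
  exact: mulmxr_continuous.
apply/funext => x /=.
by rewrite -{2}[x]hsubmxK mul_row_col mulmx1 mulmx0 add0r.
Qed.

(** The splitting of [f] is asked only near u because a transition map of a product splits only on
    the overlap: elsewhere [transition] is 0 as a whole, even if one of its factors is not. *)
Lemma has_slope_row_mx n1 n2 p1 p2 (f1 : 'rV[C]_n1 -> 'rV[C]_p1)
    (f2 : 'rV[C]_n2 -> 'rV[C]_p2) (f : 'rV[C]_(n1 + n2) -> 'rV[C]_(p1 + p2))
    u M1 M2 :
  has_slope f1 (lsubmx u) M1 -> has_slope f2 (rsubmx u) M2 ->
  (\forall x \near u, f x = row_mx (f1 (lsubmx x)) (f2 (rsubmx x))) ->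
  has_slope f u (block_mx M1 0 0 M2).
Proof.
move=> [L1 [<- L1c f1L]] [L2 [<- L2c f2L]] fE.
exists (fun x => block_mx (L1 (lsubmx x)) 0 0 (L2 (rsubmx x))); split=> //.
  move=> i j; case: (split_ordP i) => a ->; case: (split_ordP j) => b ->.
  - under eq_fun do rewrite block_mxEul; rewrite block_mxEul.
    exact: (cvg_comp _ _ (@lsubmx_continuous n1 n2 u) (L1c a b)).
  - under eq_fun do rewrite block_mxEur mxE; rewrite block_mxEur mxE.
    exact: (@cvg_cst C 0 _ (nbhs u) _).
  - under eq_fun do rewrite block_mxEdl mxE; rewrite block_mxEdl mxE.
    exact: (@cvg_cst C 0 _ (nbhs u) _).
  - under eq_fun do rewrite block_mxEdr; rewrite block_mxEdr.
    exact: (cvg_comp _ _ (@rsubmx_continuous n1 n2 u) (L2c a b)).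
have {}f1L : \forall x \near u,
    f1 (lsubmx x) - f1 (lsubmx u) = (lsubmx x - lsubmx u) *m L1 (lsubmx x).
  exact: (@lsubmx_continuous n1 n2 u _ f1L).
have {}f2L : \forall x \near u,
    f2 (rsubmx x) - f2 (rsubmx u) = (rsubmx x - rsubmx u) *m L2 (rsubmx x).
  exact: (@rsubmx_continuous n1 n2 u _ f2L).
have fu := nbhs_singleton fE.
near=> x; rewrite fu (near fE x) // opp_row_mx add_row_mx.
rewrite -[x in RHS]hsubmxK -[u in RHS]hsubmxK opp_row_mx add_row_mx.
rewrite mul_row_block !mulmx0 addr0 add0r !row_mxKl !row_mxKr.
by rewrite (near f1L x) // (near f2L x).
Unshelve. all: by end_near. Qed.

End Slopes.

(** * Transition maps between charts *)

Section Transitions.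
Variable C : numFieldType.
Implicit Types X Y : variety C.

(** Injectivity of the chart j leaves [xget] a single choice. *)
Lemma transitionE X (i j : chart_index X) u v :
  chart i u = chart j v -> transition i j u = v.
Proof.
move=> uv; apply: xget_unique => [|w /= wu]; first by rewrite /= uv.
by apply: (chart_inj (i := j)); rewrite wu.
Qed.

(** The overlap is open, being the locus where the polynomial [D] does not vanish. *)
Lemma transition_near X (i j : chart_index X) u v :
  chart i u = chart j v ->
  \forall x \near u, chart i x = chart j (transition i j x).
Proof.
move=> uv; have [D [N [Dr _ DE _]]] := chart_rational i j.
have Du : D u != 0 by apply/DE; exists v.
have : \forall x \near u, D x != 0.
  exact: (cvgr_neq0 _ (regular_continuous (u := u) Dr) Du).
by apply: filterS => x /DE[w _ wx]; rewrite (transitionE (v := w)).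
Qed.

Lemma has_slope_prod X Y (i j : chart_index (prod_variety X Y)) u v M1 M2 :
  chart i u = chart j v ->
  has_slope (transition i.1 j.1) (lsubmx u) M1 ->
  has_slope (transition i.2 j.2) (rsubmx u) M2 ->
  has_slope (transition i j) u (block_mx M1 0 0 M2).
Proof.
move=> uv M1E M2E; apply: has_slope_row_mx M1E M2E _.
apply: filterS (transition_near uv) => x [/transitionE-> /transitionE->].
by rewrite hsubmxK.
Qed.

End Transitions.

(** * Tautological and quotient bundles of a Grassmannian *)

Section GrassmannianForms.
Variables (C : numFieldType) (V : vectType C) (k : nat).
Local Notation m := (\dim {:V} - k)%N.
Implicit Types (bc : gr_index V k) (A B : 'M[C]_(k, m)) (x : V).

Definition gr_rowb bc x : 'rV[C]_k := \row_l gr_cb bc l x.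
Definition gr_rowc bc x : 'rV[C]_m := \row_j gr_cc bc j x.

(* The quotient map V -> V / <<gr_frame bc A>> in the basis induced by c *)
Definition gr_form bc A x : 'rV[C]_m := gr_rowc bc x - gr_rowb bc x *m A.

Lemma gr_rowb_linear bc : linear (gr_rowb bc).
Proof. by move=> a x y; apply/rowP => l; rewrite !mxE /gr_cb linearP. Qed.
HB.instance Definition _ bc :=
  GRing.isLinear.Build C V 'rV[C]_k _ (gr_rowb bc) (gr_rowb_linear bc).

Lemma gr_rowc_linear bc : linear (gr_rowc bc).
Proof. by move=> a x y; apply/rowP => l; rewrite !mxE /gr_cc linearP. Qed.
HB.instance Definition _ bc :=
  GRing.isLinear.Build C V 'rV[C]_m _ (gr_rowc bc) (gr_rowc_linear bc).

Lemma gr_form_linear bc A : linear (gr_form bc A).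
Proof.
move=> a x y; rewrite /gr_form !linearP mulmxDl -scalemxAl scalerBr opprD.
by rewrite addrACA.
Qed.
HB.instance Definition _ bc A :=
  GRing.isLinear.Build C V 'rV[C]_m _ (gr_form bc A) (gr_form_linear bc A).

Lemma gr_form_eq0 bc A x : gr_form bc A x = 0 <-> x \in <<gr_frame bc A>>%VS.
Proof.
rewrite gr_mem; split=> [/rowP xA j|xA]; last first.
  apply/rowP => j; rewrite !mxE xA; apply/eqP; rewrite subr_eq0; apply/eqP.
  by apply: eq_bigr => l _; rewrite mxE.
move: (xA j); rewrite !mxE => /subr0_eq->.
by apply: eq_bigr => l _; rewrite mxE.
Qed.

Lemma gr_rowb_frame bc A i : gr_rowb bc (tnth (gr_frame bc A) i) = delta_mx 0 i.
Proof. by apply/rowP => l; rewrite !mxE gr_cb_row eq_sym. Qed.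

Lemma gr_rowc_frame bc A i : gr_rowc bc (tnth (gr_frame bc A) i) = row i A.
Proof. by apply/rowP => l; rewrite !mxE gr_cc_row. Qed.

Lemma gr_rowb_c bc j : gr_rowb bc (tnth (val bc).2 j) = 0.
Proof.
apply/rowP => l; rewrite !mxE /gr_cb -gr_basisr.
by rewrite coord_free ?(basis_free (gr_basisP bc)) // eq_rlshift.
Qed.

Lemma gr_rowc_c bc j : gr_rowc bc (tnth (val bc).2 j) = delta_mx 0 j.
Proof.
apply/rowP => l; rewrite !mxE /gr_cc -gr_basisr.
by rewrite coord_free ?(basis_free (gr_basisP bc)) // eq_rshift eq_sym.
Qed.

Lemma gr_form_c bc A j : gr_form bc A (tnth (val bc).2 j) = delta_mx 0 j.
Proof. by rewrite /gr_form gr_rowb_c gr_rowc_c mul0mx subr0. Qed.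

(** This is V = U + <<c>> with U = [<<gr_frame bc A>>]: the shear from b ++ c to [gr_frame bc A] ++
    c keeps the coordinates along b and corrects those along c by [A]. *)
Lemma gr_decomp bc A x :
  x = \sum_l gr_rowb bc x 0 l *: tnth (gr_frame bc A) l
      + \sum_j gr_form bc A x 0 j *: tnth (val bc).2 j.
Proof.
rewrite {1}(gr_coordE bc x).
under [in RHS]eq_bigr do rewrite gr_row scalerDr scaler_sumr mxE.
rewrite big_split /= -addrA; congr (_ + _).
rewrite exchange_big -big_split /=; apply: eq_bigr => j _.
under eq_bigr do rewrite scalerA.
rewrite -scaler_suml -scalerDl !mxE addrCA -sumrB big1 ?addr0 // => l _.
by rewrite !mxE subrr.
Qed.

End GrassmannianForms.

(** * Transition matrices of the tautological and quotient bundles *)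

Section GrassmannianTransition.
Variables (C : numFieldType) (V : vectType C) (k : nat).
Local Notation m := (\dim {:V} - k)%N.
Variables (bc bc' : gr_index V k).
Implicit Types (A B : 'M[C]_(k, m)) (x : V).

(** The matrix P of the introduction. It is defined for every [A], with entries affine in [A], but
    it relates two frames of U only on the overlap. *)
Definition gr_sub_mx A : 'M[C]_k :=
  \matrix_i gr_rowb bc' (tnth (gr_frame bc A) i).

(** The matrix S: its rows are the classes of the vectors c in V/U, in the basis induced by c'. It
    depends on the second chart coordinate only. *)
Definition gr_quot_mx B : 'M[C]_m :=
  \matrix_j gr_form bc' B (tnth (val bc).2 j).

(** A vector of U has zero class in V/U, so only the first sum of [gr_decomp] survives. *)
Lemma gr_frame_trans A B i : <<gr_frame bc A>>%VS = <<gr_frame bc' B>>%VS ->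
  tnth (gr_frame bc A) i = \sum_l gr_sub_mx A i l *: tnth (gr_frame bc' B) l.
Proof.
move=> AB; rewrite [LHS](gr_decomp bc' B) [X in _ + X]big1 => [|j _].
  by rewrite addr0; apply: eq_bigr => l _; rewrite !mxE.
suff /gr_form_eq0-> : tnth (gr_frame bc A) i \in <<gr_frame bc' B>>%VS.
  by rewrite mxE scale0r.
by rewrite -AB; exact/memv_span/mem_tnth.
Qed.

(** Both sides kill U, so it is enough to compare them on c. *)
Lemma gr_form_trans A B x : <<gr_frame bc A>>%VS = <<gr_frame bc' B>>%VS ->
  gr_form bc' B x = gr_form bc A x *m gr_quot_mx B.
Proof.
move=> AB; rewrite {1}(gr_decomp bc A x) linearD !linear_sum /= big1 => [|l _].
  rewrite add0r mulmx_sum_row; apply: eq_bigr => j _.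
  by rewrite linearZ /= rowK.
rewrite linearZ /=.
suff /gr_form_eq0-> : tnth (gr_frame bc A) l \in <<gr_frame bc' B>>%VS.
  by rewrite scaler0.
by rewrite -AB; exact/memv_span/mem_tnth.
Qed.

Definition gr_basis_mx : 'M[C]_(k + m) :=
  \matrix_(a, b) coord (gr_basis bc') b (gr_basis bc)`_a.

(** Shears of determinant 1, by [A] on the left and [- B] on the right, replace b and b' by the two
    frames of U. The change of basis then preserves U, so it is block triangular with diagonal
    blocks P and S. *)
Lemma det_gr_basis_mx A B : <<gr_frame bc A>>%VS = <<gr_frame bc' B>>%VS ->
  \det gr_basis_mx = \det (gr_sub_mx A) * \det (gr_quot_mx B).
Proof.
move=> AB.
pose Gbb := \matrix_i gr_rowb bc' (tnth (val bc).1 i).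
pose Gbc := \matrix_i gr_rowc bc' (tnth (val bc).1 i).
pose Gcb := \matrix_j gr_rowb bc' (tnth (val bc).2 j).
pose Gcc := \matrix_j gr_rowc bc' (tnth (val bc).2 j).
have -> : gr_basis_mx = block_mx Gbb Gbc Gcb Gcc.
  apply/matrixP => a b.
  by case: (split_ordP a) => i ->; case: (split_ordP b) => j ->;
    rewrite ?(block_mxEul, block_mxEur, block_mxEdl, block_mxEdr) !mxE
      ?gr_basisl ?gr_basisr.
have PE : gr_sub_mx A = Gbb + A *m Gcb.
  apply/row_matrixP => i; rewrite linearD /= row_mul mulmx_sum_row !rowK.
  rewrite gr_row linearD linear_sum; congr (_ + _).
  by apply: eq_bigr => j _; rewrite linearZ /= rowK mxE.
(* This says that the form of [B] vanishes on the frame of [A]; it gives the zero block below. *)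
have QE : gr_sub_mx A *m B = Gbc + A *m Gcc.
  apply/row_matrixP => i.
  rewrite linearD /= !row_mul [row i A *m _]mulmx_sum_row !rowK.
  have: gr_form bc' B (tnth (gr_frame bc A) i) = 0.
    by apply/gr_form_eq0; rewrite -AB; exact/memv_span/mem_tnth.
  move=> /subr0_eq <-.
  rewrite gr_row linearD linear_sum; congr (_ + _).
  by apply: eq_bigr => j _; rewrite linearZ /= rowK mxE.
have SE : gr_quot_mx B = Gcc - Gcb *m B.
  by apply/row_matrixP => j; rewrite linearB /= row_mul !rowK.
have: block_mx 1%:M A 0 1%:M *m block_mx Gbb Gbc Gcb Gcc
      *m block_mx 1%:M (- B) 0 1%:M
    = block_mx (gr_sub_mx A) 0 Gcb (gr_quot_mx B).
  rewrite !mulmx_block !mul1mx !mul0mx !mulmx0 !mulmx1 !add0r !addr0.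
  by rewrite -PE -QE SE !mulmxN addNr [- _ + _]addrC.
move=> /(congr1 determinant).
by rewrite !det_mulmx !det_ublock det_lblock !det1 !mul1r !mulr1.
Qed.

End GrassmannianTransition.

(** * Determinants of bases and the Jacobian of a transition *)

Section GrassmannianVolume.
Variables (C : numFieldType) (V : vectType C) (k : nat).
Local Notation m := (\dim {:V} - k)%N.
Implicit Types (bc : gr_index V k).

(** The existence of an index forces k <= dim V, so the truncated subtraction in m is exact. *)
Lemma gr_index_dim bc : (k + m)%N = \dim {:V}.
Proof. by rewrite -(size_basis (gr_basisP bc)). Qed.

(** The determinant of b ++ c against a fixed basis of V, a constant on each chart. *)
Definition gr_vol bc : C := \det (\matrix_(a < k + m, b < k + m)
  coord (vbasis {:V}) (cast_ord (gr_index_dim bc) b) (gr_basis bc)`_a).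

Lemma gr_vol_trans bc bc' : gr_vol bc = \det (gr_basis_mx bc bc') * gr_vol bc'.
Proof.
rewrite -det_mulmx; congr (\det _); apply/matrixP => a b; rewrite !mxE.
rewrite {1}(coord_basis (gr_basisP bc') (memvf (gr_basis bc)`_a)) linear_sum.
apply: eq_bigr => c _; rewrite linearZ !mxE; congr (_ * coord _ _ _).
exact: val_inj.
Qed.

Lemma gr_vol_neq0 bc : gr_vol bc != 0.
Proof.
rewrite -unitfE -unitmxE.
set M := \matrix_(a, b) _.
pose N : 'M[C]_(k + m) := \matrix_(a < k + m, b < k + m)
  coord (gr_basis bc) b (vbasis {:V})`_(cast_ord (gr_index_dim bc) a).
suff /mulmx1_unit[] : M *m N = 1%:M by [].
apply/matrixP => a b; rewrite !mxE.
rewrite -(coord_free a b (basis_free (gr_basisP bc))).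
rewrite [in RHS](coord_basis (vbasisP {:V}) (memvf (gr_basis bc)`_a)).
rewrite linear_sum.
rewrite (reindex (cast_ord (gr_index_dim bc))) /=; last first.
  exists (cast_ord (esym (gr_index_dim bc))) => i _;
    by rewrite ?cast_ordK ?cast_ordKV.
by apply: eq_bigr => c _; rewrite linearZ !mxE.
Qed.

Section Transition.
Variables (bc bc' : gr_index V k) (A B : 'M[C]_(k, m)).
Hypothesis AB : <<gr_frame bc A>>%VS = <<gr_frame bc' B>>%VS.

(** In cocycles, det U (x) det V/U = det V is trivial: its transition functions are quotients of the
    constants [gr_vol]. *)
Lemma gr_det_sub_quot :
  \det (gr_sub_mx bc bc' A) * \det (gr_quot_mx bc bc' B) * gr_vol bc'
  = gr_vol bc.
Proof. by rewrite -(det_gr_basis_mx AB) -gr_vol_trans. Qed.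

Lemma gr_sub_mx_unit : gr_sub_mx bc bc' A \in unitmx.
Proof.
rewrite unitmxE unitfE; apply: contra_neq (gr_vol_neq0 bc) => d0.
by rewrite -gr_det_sub_quot d0 !mul0r.
Qed.

End Transition.

(** Here [A], [B] are the coordinates of one point in the two charts and [A'], [B'] those of
    another. The quotient form of the first point is evaluated on the frame of the second, once
    through each chart. *)
Lemma gr_trans_sub bc bc' (A B A' B' : 'M[C]_(k, m)) :
  <<gr_frame bc A>>%VS = <<gr_frame bc' B>>%VS ->
  <<gr_frame bc A'>>%VS = <<gr_frame bc' B'>>%VS ->
  gr_sub_mx bc bc' A' *m (B' - B) = (A' - A) *m gr_quot_mx bc bc' B.
Proof.
move=> AB AB'; apply/row_matrixP => i; rewrite !row_mul.
have -> : row i (A' - A) = gr_form bc A (tnth (gr_frame bc A') i).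
  rewrite /gr_form gr_rowb_frame gr_rowc_frame -rowE.
  by rewrite linearB.
rewrite -(gr_form_trans _ AB) (gr_frame_trans i AB') linear_sum mulmx_sum_row.
apply: eq_bigr => l _; rewrite linearZ !mxE /=; congr (_ *: _).
by rewrite /gr_form gr_rowb_frame gr_rowc_frame -rowE linearB.
Qed.

Lemma gr_sub_mx_regular bc bc' i l :
  regular_fun (fun u : 'rV[C]_(k * m) => gr_sub_mx bc bc' (vec_mx u) i l).
Proof.
apply: (@eq_regular _ _ (fun u => gr_rowb bc' (tnth (val bc).1 i) 0 l +
    \sum_j u 0 (mxvec_index i j) * gr_rowb bc' (tnth (val bc).2 j) 0 l)).
  move=> u.
  rewrite 3!mxE gr_row /gr_cb linearD linear_sum; congr (_ + _).
  by apply: eq_bigr => j _; rewrite linearZ !mxE.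
apply: regularD; first exact: regular_cst.
by apply: regular_sum => j; apply: regularM;
  [exact: regular_coord | exact: regular_cst].
Qed.

Lemma gr_has_slope (bc bc' : chart_index (Gr V k)) u v :
  chart bc u = chart bc' v ->
  has_slope (@transition _ (Gr V k) bc bc') u
    (lin_mulmx (invmx (gr_sub_mx bc bc' (vec_mx u))) *m
     lin_mulmxr (gr_quot_mx bc bc' (vec_mx v))).
Proof.
move=> uv.
pose P (x : 'rV[C]_(k * m)) := gr_sub_mx bc bc' (vec_mx x).
pose S := gr_quot_mx bc bc' (vec_mx v).
(* [Q] is given by one formula for all x, so its entries are visibly continuous at u; [invmx] is
   defined by cases. *)
pose Q x := (\det (P x))^-1 *: \adj (P x).
have QE x : P x \in unitmx -> Q x = invmx (P x) by move=> Px; rewrite /invmx Px.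
have Pu : P u \in unitmx by apply: (@gr_sub_mx_unit _ _ _ (vec_mx v)).
exists (fun x => lin_mulmx (Q x) *m lin_mulmxr S); split.
- by rewrite QE.
- move=> i j.
  have Qc a b : Q x a b @[x --> u] --> Q u a b.
    under eq_fun do rewrite mxE; rewrite mxE.
    have Pr := gr_sub_mx_regular bc bc'.
    have detc := regular_continuous (u := u) (regular_det Pr).
    have adjc := regular_continuous (u := u) (regular_adj a b Pr).
    by apply: (cvgM (cvgV _ detc) adjc); rewrite -unitfE -unitmxE.
  (* [F] is linear, so continuity of its entries reduces to that of the entries of [Q]. *)
  pose F (M : 'M[C]_k) := lin_mulmx M *m (lin_mulmxr S : 'M_(k * m)).
  have FE M : F M i j = \sum_a \sum_b M a b * F (delta_mx a b) i j.
    rewrite {1}[M]matrix_sum_delta /F linear_sum mulmx_suml summxE.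
    apply: eq_bigr => a _; rewrite linear_sum mulmx_suml summxE.
    by apply: eq_bigr => b _; rewrite linearZ -scalemxAl mxE.
  rewrite -/(F (Q u)) FE.
  under eq_fun do rewrite -/(F _) FE.
  apply: cvg_sum => a; apply: cvg_sum => b.
  exact: (cvgM (Qc a b) (cvg_cst _)).
(* On the overlap the slope equation is [gr_trans_sub] multiplied on the left by the inverse of
   [P x]. *)
- have xc := transition_near uv.
  near=> x.
  have xt : chart bc x = chart bc' (transition bc bc' x) by exact: (near xc x).
  have Px : P x \in unitmx by exact: (gr_sub_mx_unit xt).
  rewrite QE // (transitionE uv) mulmxA.
  rewrite !mul_rV_lin /= mxvecK -mulmxA linearB -(gr_trans_sub uv xt) mulKmx //.
  by rewrite linearB /= !vec_mxK.
Unshelve. all: by end_near. Qed.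

Lemma gr_canonical (bc bc' : chart_index (Gr V k)) u v :
  chart bc u = chart bc' v ->
  canonical_bundle (Gr V k) bc bc' u * \det (gr_sub_mx bc bc' (vec_mx u)) ^+ m
  = \det (gr_quot_mx bc bc' (vec_mx v)) ^+ k.
Proof.
move=> uv; rewrite /canonical_bundle (has_slope_jacobian (gr_has_slope uv)).
have Pu := gr_sub_mx_unit uv.
rewrite det_mulmx det_lin_mulmx det_lin_mulmxr mulrAC -exprMn det_inv.
rewrite mulVf ?expr1n ?mul1r //.
by rewrite -unitfE -unitmxE.
Qed.

End GrassmannianVolume.

(** * Regular frames *)

Section RegularVectors.
Variables (C : numFieldType) (n : nat).
Implicit Types E : vectType C.

Lemma regular_vect_cst E (x : E) : regular_vect (fun _ : 'rV[C]_n => x).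
Proof. by move=> a; exact: regular_cst. Qed.

Lemma regular_vectD E (f g : 'rV[C]_n -> E) :
  regular_vect f -> regular_vect g -> regular_vect (fun u => f u + g u).
Proof.
move=> fr gr a; apply: eq_regular (regularD (fr a) (gr a)) => u.
by rewrite linearD.
Qed.

Lemma regular_vect_sum E (I : Type) (r : seq I) (f : I -> 'rV[C]_n -> E) :
  (forall i, regular_vect (f i)) -> regular_vect (fun u => \sum_(i <- r) f i u).
Proof.
move=> fr a; apply: (eq_regular _ (regular_sum r (fun i => fr i a))) => u.
by rewrite linear_sum.
Qed.

Lemma regular_vectZ E (f : 'rV[C]_n -> C) (g : 'rV[C]_n -> E) :
  regular_fun f -> regular_vect g -> regular_vect (fun u => f u *: g u).
Proof.
move=> fr gr a; apply: eq_regular (regularM fr (gr a)) => u.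
by rewrite linearZ.
Qed.

Lemma regular_vect_lin E E' (f : {linear E -> E'}) (g : 'rV[C]_n -> E) :
  regular_vect g -> regular_vect (fun u => f (g u)).
Proof.
move=> gr a.
apply: (@eq_regular _ _ (fun u => \sum_b coord (vbasis {:E}) b (g u) *
    coord (vbasis {:E'}) a (f (vbasis {:E})`_b))) => [u|].
  rewrite [in RHS](coord_vbasis (memvf (g u))) !linear_sum.
  by apply: eq_bigr => b _; rewrite !linearZ.
by apply: regular_sum => b; apply: regularM; [exact: gr | exact: regular_cst].
Qed.

(** The tensor of the i-th dual basis vector with [w]. These maps reduce regularity of a family of
    linear maps to that of its values on a basis. *)
Definition rank1_hom (V W : vectType C) i (w : W) : 'Hom(V, W) :=
  linfun (fun x : V => coord (vbasis {:V}) i x *: w).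

Lemma rank1_homE (V W : vectType C) i (w : W) (x : V) :
  rank1_hom i w x = coord (vbasis {:V}) i x *: w.
Proof.
have lin : linear (fun x : V => coord (vbasis {:V}) i x *: w).
  by move=> a y z; rewrite linearP /= scalerDl scalerA.
pose f := GRing.isLinear.Build C V W _ _ lin.
pose g : {linear V -> W} :=
  HB.pack (fun x : V => coord (vbasis {:V}) i x *: w) f.
exact: (lfunE g).
Qed.

Lemma rank1_hom_linear (V W : vectType C) i : linear (@rank1_hom V W i).
Proof.
move=> a w w'; apply/lfunP => x.
by rewrite add_lfunE scale_lfunE !rank1_homE scalerDr !scalerA mulrC.
Qed.
HB.instance Definition _ (V W : vectType C) i :=
  GRing.isLinear.Build C W 'Hom(V, W) _ (@rank1_hom V W i) (rank1_hom_linear i).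

Lemma regular_vect_hom (V W : vectType C) (f : 'rV[C]_n -> 'Hom(V, W)) :
  (forall x, regular_vect (fun u => f u x)) -> regular_vect f.
Proof.
move=> fr.
have -> : f = fun u => \sum_i rank1_hom i (f u (vbasis {:V})`_i).
  apply/funext => u; apply/lfunP => x; rewrite sum_lfunE.
  rewrite {1}(coord_vbasis (memvf x)) linear_sum.
  by apply: eq_bigr => i _; rewrite rank1_homE linearZ.
by apply: regular_vect_sum => i; exact: regular_vect_lin.
Qed.

End RegularVectors.

(** * Frames given by linear parametrisations *)

Section LinearFrames.
Variables (C : numFieldType) (E : vectType C) (n : nat).
Variable f : {linear 'rV[C]_n -> E}.

(** With frames in this form, freeness is injectivity of [f], the span is its image, and the matrix
    between the frames of [f] and [g] is any [M] with [g z = f (z *m M)]. *)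
Definition lin_frame : n.-tuple E := [tuple f (delta_mx 0 i) | i < n].

Lemma lin_frame_comb (z : 'rV[C]_n) : f z = \sum_i z 0 i *: lin_frame`_i.
Proof.
rewrite {1}(row_sum_delta z) linear_sum; apply: eq_bigr => i _.
by rewrite linearZ -tnth_nth tnth_mktuple.
Qed.

Lemma lin_frame_free : (forall z, f z = 0 -> z = 0) -> free lin_frame.
Proof.
move=> f0; apply/freeP => z z0 i.
have : f (\row_j z j) = 0.
  by rewrite lin_frame_comb -[RHS]z0; apply: eq_bigr => j _; rewrite mxE.
by move=> /f0/rowP/(_ i); rewrite !mxE.
Qed.

Lemma lin_frame_span x : x \in <<lin_frame>>%VS <-> exists z, x = f z.
Proof.
split=> [/coord_span xE|[z ->]].
  exists (\row_i coord lin_frame i x); rewrite lin_frame_comb [LHS]xE.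
  by apply: eq_bigr => i _; rewrite mxE.
rewrite lin_frame_comb; apply: rpred_sum => i _; apply: rpredZ.
by rewrite -tnth_nth; exact/memv_span/mem_tnth.
Qed.

End LinearFrames.

Lemma coord_lin_frame (C : numFieldType) (E : vectType C) n
    (f g : {linear 'rV[C]_n -> E}) (M : 'M[C]_n) :
  free (lin_frame f) -> (forall z, g z = f (z *m M)) ->
  \matrix_(a, b) coord (lin_frame f) b (tnth (lin_frame g) a) = M.
Proof.
move=> ffree gf; apply/matrixP => a b.
by rewrite mxE tnth_mktuple gf -rowE lin_frame_comb coord_sum_free // mxE.
Qed.

(** * Matrix coordinates on Hom(V/U, <<r>>) *)

Section HomFrames.
Variables (C : numFieldType) (V W : vectType C) (q n : nat).
Local Notation m := (\dim {:V} - q)%N.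
Implicit Types (bc : gr_index V q) (A : 'M[C]_(q, m)) (r : n.-tuple W).

Definition hom_comb_fun bc A r (X : 'M[C]_(m, n)) (x : V) : W :=
  \sum_a (gr_form bc A x *m X) 0 a *: tnth r a.

Lemma hom_comb_fun_linear bc A r X : linear (hom_comb_fun bc A r X).
Proof.
move=> a x y; rewrite /hom_comb_fun scaler_sumr -big_split.
apply: eq_bigr => i _; rewrite linearP mulmxDl -scalemxAl mxE.
by rewrite [X in (X + _) *: _]mxE scalerDl scalerA.
Qed.
HB.instance Definition _ bc A r X :=
  GRing.isLinear.Build C V W _ (hom_comb_fun bc A r X)
    (hom_comb_fun_linear bc A r X).

(* The isomorphism from the matrices to Hom(V / <<gr_frame bc A>>, <<r>>) *)
Definition hom_comb bc A r X : 'Hom(V, W) := linfun (hom_comb_fun bc A r X).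

Lemma hom_combE bc A r X x :
  hom_comb bc A r X x = \sum_a (gr_form bc A x *m X) 0 a *: tnth r a.
Proof. by rewrite lfunE. Qed.

Lemma hom_comb_linear bc A r : linear (hom_comb bc A r).
Proof.
move=> a X Y; apply/lfunP => x; rewrite add_lfunE scale_lfunE !hom_combE.
rewrite scaler_sumr -big_split; apply: eq_bigr => i _.
by rewrite mulmxDr -scalemxAr mxE [X in (X + _) *: _]mxE scalerDl scalerA.
Qed.
HB.instance Definition _ bc A r :=
  GRing.isLinear.Build C 'M[C]_(m, n) 'Hom(V, W) _ (hom_comb bc A r)
    (hom_comb_linear bc A r).

Lemma hom_comb_c bc A r X j :
  hom_comb bc A r X (tnth (val bc).2 j) = \sum_a X j a *: tnth r a.
Proof.
by rewrite hom_combE gr_form_c -rowE; apply: eq_bigr => a _; rewrite mxE.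
Qed.

Lemma hom_comb_eq0 bc A r X : free r -> hom_comb bc A r X = 0 -> X = 0.
Proof.
move=> /freeP rfree X0; apply/matrixP => j a; rewrite mxE.
apply: (rfree (X j)).
under eq_bigr do rewrite -tnth_nth.
by rewrite -(hom_comb_c bc A) X0 zero_lfunE.
Qed.

Lemma hom_combP bc A r (phi : 'Hom(V, W)) :
  (<<gr_frame bc A>> <= lker phi)%VS /\ (limg phi <= <<r>>)%VS <->
  exists X, phi = hom_comb bc A r X.
Proof.
split=> [[kphi iphi]|[X ->]].
  (* A map that kills U is determined by its values on c, whose coordinates along [r] are the rows
     of this matrix. *)
  exists (\matrix_(j, a) coord r a (phi (tnth (val bc).2 j))).
  apply/lfunP => x; rewrite hom_combE {1}(gr_decomp bc A x) linearD !linear_sum.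
  rewrite [X in X + _]big1 ?add0r => [|l _]; last first.
    rewrite linearZ /=; have : tnth (gr_frame bc A) l \in lker phi.
      exact/(subvP kphi)/memv_span/mem_tnth.
    by rewrite memv_ker => /eqP->; rewrite scaler0.
  under [RHS]eq_bigr do rewrite mxE scaler_suml.
  rewrite exchange_big; apply: eq_bigr => j _; rewrite linearZ /=.
  have : phi (tnth (val bc).2 j) \in <<r>>%VS.
    by apply: (subvP iphi); exact/memv_img/memvf.
  move=> /coord_span {1}->; rewrite scaler_sumr; apply: eq_bigr => a _.
  by rewrite -tnth_nth mxE scalerA.
split.
  apply/subvP => x /gr_form_eq0 x0; rewrite memv_ker hom_combE x0 mul0mx.
  by rewrite big1 // => a _; rewrite mxE scale0r.
apply/subvP => _ /memv_imgP[x _ ->]; rewrite hom_combE.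
by apply: rpred_sum => a _; apply/rpredZ/memv_span/mem_tnth.
Qed.

(** The form contributes S by [gr_form_trans], and passing from [r'] back to [r] contributes the
    inverse of [P]. *)
Lemma hom_comb_trans bc bc' A B r r' (P : 'M[C]_n) X :
  <<gr_frame bc A>>%VS = <<gr_frame bc' B>>%VS -> P \in unitmx ->
  (forall i, tnth r i = \sum_l P i l *: tnth r' l) ->
  hom_comb bc' B r' X
  = hom_comb bc A r (gr_quot_mx bc bc' B *m X *m invmx P).
Proof.
move=> AB Pu rr'; apply/lfunP => x; rewrite !hom_combE.
rewrite (gr_form_trans _ AB) !mulmxA.
set y := _ *m X; under [RHS]eq_bigr do rewrite rr' scaler_sumr.
rewrite exchange_big; apply: eq_bigr => l _ /=.
rewrite -{1}(mulmxKV Pu y) mxE scaler_suml.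
by apply: eq_bigr => i _; rewrite scalerA.
Qed.

Lemma hom_comb_regular d bc (A : 'rV[C]_d -> 'M[C]_(q, m))
    (r : 'rV[C]_d -> n.-tuple W) X :
  (forall i j, regular_fun (fun u => A u i j)) ->
  (forall i, regular_vect (fun u => tnth (r u) i)) ->
  regular_vect (fun u => hom_comb bc (A u) (r u) X).
Proof.
move=> Ar rr; apply: regular_vect_hom => x.
rewrite (_ : (fun u => _) = fun u => \sum_a
    (\sum_j (gr_cc bc j x - \sum_l gr_cb bc l x * A u l j) * X j a)
      *: tnth (r u) a).
  apply: regular_vect_sum => a; apply: regular_vectZ => //.
  apply: regular_sum => j; apply: regularM; last exact: regular_cst.
  apply: (@eq_regular _ _ (fun u =>
      gr_cc bc j x + \sum_l (- gr_cb bc l x) * A u l j)).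
    move=> u; rewrite -sumrN; congr (_ + _).
    by apply: eq_bigr => l _; rewrite mulNr.
  apply: regularD; first exact: regular_cst.
  by apply: regular_sum => l; apply: regularM => //; exact: regular_cst.
apply/funext => u; rewrite hom_combE; apply: eq_bigr => a _.
rewrite mxE; congr (_ *: _); apply: eq_bigr => j _; rewrite !mxE.
by congr ((_ - _) * _); apply: eq_bigr => l _; rewrite mxE.
Qed.

End HomFrames.

Lemma gr_frame_regular (C : numFieldType) (V : vectType C) k d
    (bc : gr_index V k) (A : 'rV[C]_d -> 'M[C]_(k, \dim {:V} - k)) i :
  (forall i j, regular_fun (fun u => A u i j)) ->
  regular_vect (fun u => tnth (gr_frame bc (A u)) i).
Proof.
move=> Ar; under eq_fun do rewrite gr_row.
apply: regular_vectD; first exact: regular_vect_cst.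
apply: regular_vect_sum => j; apply: regular_vectZ => //.
exact: regular_vect_cst.
Qed.

Lemma regular_vect_pair (C : numFieldType) (E E' : vectType C) d
    (f : 'rV[C]_d -> E) (g : 'rV[C]_d -> E') :
  regular_vect f -> regular_vect g ->
  regular_vect (fun u => (f u, g u) : (E * E')%type).
Proof.
move=> fr gr.
have linl : linear (fun x : E => (x, 0) : (E * E')%type).
  by move=> a x y; congr pair; rewrite /= scaler0 addr0.
have linr : linear (fun y : E' => (0, y) : (E * E')%type).
  by move=> a x y; congr pair; rewrite /= scaler0 addr0.
pose fl := GRing.isLinear.Build C E (E * E')%type _ _ linl.
pose fr' := GRing.isLinear.Build C E' (E * E')%type _ _ linr.
pose inl : {linear E -> (E * E')%type} :=
  HB.pack (fun x : E => (x, 0) : (E * E')%type) fl.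
pose inr : {linear E' -> (E * E')%type} :=
  HB.pack (fun y : E' => (0, y) : (E * E')%type) fr'.
have -> : (fun u => (f u, g u)) = fun u => inl (f u) + inr (g u).
  by apply/funext => u; congr pair; rewrite ?addr0 ?add0r.
by apply: regular_vectD; exact: regular_vect_lin.
Qed.

(** * Frames of Q_2^* (x) (U_1 (+) U_3) *)

Section RepFrames.
Variables (C : numFieldType) (V1 V2 V3 : vectType C) (q n1 n3 : nat).
Local Notation m := (\dim {:V2} - q)%N.
Local Notation rank := (m * n1 + m * n3)%N.
Implicit Types (bc : gr_index V2 q) (A : 'M[C]_(q, m)).

Definition rep_comb bc A (r1 : n1.-tuple V1) (r3 : n3.-tuple V3)
    (z : 'rV[C]_rank) : rep V1 V2 V3 :=
  (hom_comb bc A r1 (vec_mx (lsubmx z)), hom_comb bc A r3 (vec_mx (rsubmx z))).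

Lemma rep_comb_linear bc A r1 r3 : linear (rep_comb bc A r1 r3).
Proof. by move=> a y z; rewrite /rep_comb !linearP. Qed.
HB.instance Definition _ bc A r1 r3 :=
  GRing.isLinear.Build C 'rV[C]_rank (rep V1 V2 V3) _ (rep_comb bc A r1 r3)
    (rep_comb_linear bc A r1 r3).

Definition rep_frame bc A (r1 : n1.-tuple V1) (r3 : n3.-tuple V3) :
    rank.-tuple (rep V1 V2 V3) :=
  lin_frame (rep_comb bc A r1 r3).

Lemma rep_frame_free bc A (r1 : n1.-tuple V1) (r3 : n3.-tuple V3) :
  free r1 -> free r3 -> free (rep_frame bc A r1 r3).
Proof.
move=> r1free r3free; apply: lin_frame_free => z [].
move=> /(hom_comb_eq0 r1free) z1 /(hom_comb_eq0 r3free) z3.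
rewrite -[z]hsubmxK -[lsubmx z]vec_mxK -[rsubmx z]vec_mxK z1 z3.
by rewrite !linear0 row_mx0.
Qed.

Lemma rep_frame_span bc A r1 r3 :
  [set` <<rep_frame bc A r1 r3>>%VS] =
  [set phi : rep V1 V2 V3 |
    [/\ (<<gr_frame bc A>> <= lker phi.1)%VS,
        (<<gr_frame bc A>> <= lker phi.2)%VS,
        (limg phi.1 <= <<r1>>)%VS & (limg phi.2 <= <<r3>>)%VS]].
Proof.
apply/seteqP; split=> [phi /= /lin_frame_span[z ->]|].
  have [] := (hom_combP bc A r1 (rep_comb bc A r1 r3 z).1).2.
    by eexists.
  have [] := (hom_combP bc A r3 (rep_comb bc A r1 r3 z).2).2; first by eexists.
  by move=> ? ? ? ?; split.
move=> [phi1 phi2] /= [k1 k2 i1 i2].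
have [X1 ->] := (hom_combP bc A r1 phi1).1 (conj k1 i1).
have [X3 ->] := (hom_combP bc A r3 phi2).1 (conj k2 i2).
apply/lin_frame_span; exists (row_mx (mxvec X1) (mxvec X3)).
by rewrite /= /rep_comb row_mxKl row_mxKr !mxvecK.
Qed.

(** The change of frame is X |-> S X P^-1 on each summand, of determinant (det S)^n (det P)^-m with
    n the rank of that summand. Denominators are cleared in the statement. *)
Lemma rep_frame_det bc bc' A B (r1 r1' : n1.-tuple V1) (r3 r3' : n3.-tuple V3)
    (P1 : 'M[C]_n1) (P3 : 'M[C]_n3) :
  <<gr_frame bc A>>%VS = <<gr_frame bc' B>>%VS ->
  free r1 -> free r3 -> P1 \in unitmx -> P3 \in unitmx ->
  (forall i, tnth r1 i = \sum_l P1 i l *: tnth r1' l) ->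
  (forall i, tnth r3 i = \sum_l P3 i l *: tnth r3' l) ->
  \det (\matrix_(a, b) coord (rep_frame bc A r1 r3) b
          (tnth (rep_frame bc' B r1' r3') a)) * (\det P1 * \det P3) ^+ m
  = \det (gr_quot_mx bc bc' B) ^+ (n1 + n3).
Proof.
move=> AB r1free r3free P1u P3u r1E r3E; set S := gr_quot_mx bc bc' B.
pose M : 'M[C]_rank := block_mx (lin_mulmx S *m lin_mulmxr (invmx P1)) 0
  0 (lin_mulmx S *m lin_mulmxr (invmx P3)).
rewrite (coord_lin_frame (M := M)).
- rewrite det_ublock !det_mulmx !det_lin_mulmx !det_lin_mulmxr !det_inv.
  have d1 : \det P1 ^+ m != 0 by rewrite expf_neq0 // -unitfE -unitmxE.
  have d3 : \det P3 ^+ m != 0 by rewrite expf_neq0 // -unitfE -unitmxE.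
  by rewrite exprMn mulrACA !exprVn !mulfVK // -exprD.
- exact: rep_frame_free.
move=> z; rewrite /= /rep_comb -[z]hsubmxK mul_row_block !mulmx0 addr0 add0r.
rewrite !row_mxKl !row_mxKr !mulmxA !mul_rV_lin /= !mxvecK.
by rewrite (hom_comb_trans _ AB P1u r1E) (hom_comb_trans _ AB P3u r3E).
Qed.

Lemma rep_frame_regular d bc (A : 'rV[C]_d -> 'M[C]_(q, m))
    (r1 : 'rV[C]_d -> n1.-tuple V1) (r3 : 'rV[C]_d -> n3.-tuple V3) a :
  (forall i j, regular_fun (fun u => A u i j)) ->
  (forall i, regular_vect (fun u => tnth (r1 u) i)) ->
  (forall i, regular_vect (fun u => tnth (r3 u) i)) ->
  regular_vect (fun u => tnth (rep_frame bc (A u) (r1 u) (r3 u)) a).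
Proof.
move=> Ar r1r r3r; under eq_fun do rewrite tnth_mktuple.
by apply: regular_vect_pair; exact: hom_comb_regular.
Qed.

End RepFrames.

(** * Canonical bundles and crepancy *)

Section CanonicalBundle.
Variable C : numFieldType.
Implicit Types X Y : variety C.

(** Smoothness of the transition maps, in a form that passes to products; it justifies computing
    [jacobian] by blocks in [canonical_prod]. *)
Definition sloped X := forall (i j : chart_index X) u v,
  chart i u = chart j v -> exists M, has_slope (transition i j) u M.

Lemma sloped_Gr (V : vectType C) k : sloped (Gr V k).
Proof. by move=> i j u v uv; eexists; exact: gr_has_slope uv. Qed.

Lemma sloped_prod X Y : sloped X -> sloped Y -> sloped (prod_variety X Y).
Proof.
move=> sX sY i j u v uv; case: (uv) => /sX[M1 uM1] /sY[M2 uM2].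
by eexists; exact: has_slope_prod uv uM1 uM2.
Qed.

Lemma canonical_prod X Y (i j : chart_index (prod_variety X Y)) u v :
  sloped X -> sloped Y -> chart i u = chart j v ->
  canonical_bundle (prod_variety X Y) i j u
  = canonical_bundle X i.1 j.1 (lsubmx u)
    * canonical_bundle Y i.2 j.2 (rsubmx u).
Proof.
move=> sX sY uv; case: (uv) => /sX[M1 uM1] /sY[M2 uM2].
rewrite /canonical_bundle (has_slope_jacobian (has_slope_prod uv uM1 uM2)).
by rewrite det_ublock (has_slope_jacobian uM1) (has_slope_jacobian uM2).
Qed.

Section Grassmannian.
Variables (V : vectType C) (k : nat).
Local Notation m := (\dim {:V} - k)%N.
Variables (bc bc' : chart_index (Gr V k)) (u v : 'rV[C]_(k * m)).
Hypothesis uv : chart bc u = chart bc' v.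

Let expr_dim (x : C) : x ^+ \dim {:V} = x ^+ k * x ^+ m.
Proof. by rewrite -exprD (gr_index_dim bc). Qed.

(* K is isomorphic to (det U)^(dim V), up to constants *)
Lemma gr_canonical_sub :
  canonical_bundle (Gr V k) bc bc' u
    * \det (gr_sub_mx bc bc' (vec_mx u)) ^+ \dim {:V} * gr_vol bc' ^+ k
  = gr_vol bc ^+ k.
Proof.
rewrite expr_dim -(gr_det_sub_quot uv) !exprMn -(gr_canonical uv).
congr (_ * _); by rewrite [RHS]mulrC mulrAC mulrA.
Qed.

(* K is isomorphic to (det V/U)^(-dim V), up to constants *)
Lemma gr_canonical_quot :
  \det (gr_quot_mx bc bc' (vec_mx v)) ^+ \dim {:V} * gr_vol bc' ^+ m
  = canonical_bundle (Gr V k) bc bc' u * gr_vol bc ^+ m.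
Proof.
rewrite -(gr_det_sub_quot uv) !exprMn !mulrA (gr_canonical uv).
by rewrite expr_dim.
Qed.

End Grassmannian.
End CanonicalBundle.

(** A criterion common to both types: [r1] and [r3] may be frames of tautological bundles or
    constant bases. The last hypothesis is the cocycle identity between det W and K with
    denominators cleared, for a function [h] constant on each chart. *)
Lemma crepant_rep (C : numFieldType) (V1 V2 V3 : vectType C) (q n1 n3 : nat)
    (Z : resolution (rep V1 V2 V3)) (X := res_base Z)
    (bc : chart_index X -> gr_index V2 q)
    (A : chart_index X -> 'rV[C]_(vdim X) -> 'M[C]_(q, \dim {:V2} - q))
    (r1 : chart_index X -> 'rV[C]_(vdim X) -> n1.-tuple V1)
    (r3 : chart_index X -> 'rV[C]_(vdim X) -> n3.-tuple V3)
    (h : chart_index X -> C) :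
  (forall i a b, regular_fun (fun u => A i u a b)) ->
  (forall i a, regular_vect (fun u => tnth (r1 i u) a)) ->
  (forall i a, regular_vect (fun u => tnth (r3 i u) a)) ->
  (forall i u, free (r1 i u)) -> (forall i u, free (r3 i u)) ->
  (forall i u, @res_bundle _ _ Z (chart i u) =
    [set phi : rep V1 V2 V3 |
      [/\ (<<gr_frame (bc i) (A i u)>> <= lker phi.1)%VS,
          (<<gr_frame (bc i) (A i u)>> <= lker phi.2)%VS,
          (limg phi.1 <= <<r1 i u>>)%VS & (limg phi.2 <= <<r3 i u>>)%VS]]) ->
  (forall i, h i != 0) ->
  (forall i j u v, chart i u = chart j v ->
    exists (P1 : 'M[C]_n1) (P3 : 'M[C]_n3),
    [/\ <<gr_frame (bc i) (A i u)>>%VS = <<gr_frame (bc j) (A j v)>>%VS,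
        P1 \in unitmx /\
          (forall a, tnth (r1 i u) a = \sum_l P1 a l *: tnth (r1 j v) l),
        P3 \in unitmx /\
          (forall a, tnth (r3 i u) a = \sum_l P3 a l *: tnth (r3 j v) l) &
        \det (gr_quot_mx (bc i) (bc j) (A j v)) ^+ (n1 + n3) * h i
        = h j * canonical_bundle X i j u
            * (\det P1 * \det P3) ^+ (\dim {:V2} - q)]) ->
  crepant Z.
Proof.
move=> Ar r1r r3r r1f r3f ZE h0 trans.
exists _, (fun i u => rep_frame (bc i) (A i u) (r1 i u) (r3 i u)); split.
  move=> i; split=> [a|u]; first exact: rep_frame_regular.
  by split; [exact: rep_frame_free | rewrite rep_frame_span -ZE].
exists (fun i _ => h i).
split=> [i|i u|i j u v uv]; [exact: regular_cst | exact: h0 |].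
have [P1 [P3 [AB [P1u P1E] [P3u P3E] E]]] := trans _ _ _ _ uv.
rewrite /det_bundle (transitionE uv).
have := rep_frame_det AB (r1f i u) (r3f i u) P1u P3u P1E P3E.
set p := (_ * _) ^+ _ in E *; move=> dE.
have p0 : p != 0 by rewrite expf_neq0 // mulf_neq0 // -unitfE -unitmxE.
by apply: (mulIf p0); rewrite mulrAC dE E.
Qed.

(** * Matching of exponents for the two resolutions *)

Section Resolutions.
Variables (C : numFieldType) (V1 V2 V3 : vectType C).

(** Up to constants, K is (det U_1)^d1 (det Q_2)^-d2 (det U_3)^d3, while det W is (det U_1 det
    U_3)^(d2 - q) (det Q_2)^-(2 d2 - k1 - k2); the hypotheses identify the exponents. *)
Lemma crepant_resolution_i (k1 k2 q : nat) :
  \dim {:V1} = (\dim {:V2} - q)%N -> \dim {:V3} = (\dim {:V2} - q)%N ->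
  (k1 + k2)%N = \dim {:V2} ->
  crepant (resolution_i V1 V2 V3 k1 k2 q).
Proof.
move=> d1 d3 k12.
have n13 : (\dim {:V2} - k1 + (\dim {:V2} - k2))%N = \dim {:V2}.
  by rewrite -k12 addKn addnK addnC.
apply: (@crepant_rep C V1 V2 V3 q (\dim {:V2} - k1) (\dim {:V2} - k2)
  (resolution_i V1 V2 V3 k1 k2 q)
  (fun i => i.1.2) (fun i u => vec_mx (rsubmx (lsubmx u)))
  (fun i u => gr_frame i.1.1 (vec_mx (lsubmx (lsubmx u))))
  (fun i u => gr_frame i.2 (vec_mx (rsubmx u)))
  (* The product of the constants that occur in [gr_canonical_sub] for the factors 1 and 3 and in
     [gr_canonical_quot] for the factor 2. *)
  (fun i => gr_vol i.1.1 ^+ (\dim {:V2} - k1) * gr_vol i.2 ^+ (\dim {:V2} - k2)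
            / gr_vol i.1.2 ^+ (\dim {:V2} - q))).
- by move=> i a b; apply: (eq_regular _ (regular_coord _ _)) => u; rewrite !mxE.
- move=> i a; apply: gr_frame_regular => {}a b.
  by apply: (eq_regular _ (regular_coord _ _)) => u; rewrite !mxE.
- move=> i a; apply: gr_frame_regular => {}a b.
  by apply: (eq_regular _ (regular_coord _ _)) => u; rewrite !mxE.
- by move=> i u; exact: gr_free.
- by move=> i u; exact: gr_free.
- by [].
- by move=> i; rewrite !mulf_neq0 ?invr_neq0 ?expf_neq0 ?gr_vol_neq0.
move=> i j u v uv; case: (uv) => uv1 uv2 uv3.
exists (gr_sub_mx i.1.1 j.1.1 (vec_mx (lsubmx (lsubmx u)))).
exists (gr_sub_mx i.2 j.2 (vec_mx (rsubmx u))); split.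
- exact: uv2.
- by split=> [|a]; [exact: gr_sub_mx_unit uv1 | exact: gr_frame_trans uv1].
- by split=> [|a]; [exact: gr_sub_mx_unit uv3 | exact: gr_frame_trans uv3].
rewrite (canonical_prod _ _ uv); last exact: sloped_Gr; last first.
  exact: sloped_prod (@sloped_Gr _ _ _) (@sloped_Gr _ _ _).
rewrite (canonical_prod _ _ (congr1 fst uv)); [|exact: sloped_Gr..].
have := gr_canonical_sub uv1; have := gr_canonical_sub uv3.
have := gr_canonical_quot uv2.
(* [congr1] confines the rewriting to exponents, since [\dim {:V1}] and [\dim {:V3}] also occur in
   the sizes of matrices. *)
rewrite /= n13 exprMn (congr1 (GRing.exp _) d1) (congr1 (GRing.exp _) d3).
have bi0 : gr_vol i.1.2 ^+ (\dim {:V2} - q) != 0.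
  by rewrite expf_neq0 ?gr_vol_neq0.
have bj0 : gr_vol j.1.2 ^+ (\dim {:V2} - q) != 0.
  by rewrite expf_neq0 ?gr_vol_neq0.
move=> /(canRL (mulfK bj0))-> <- <-; field.
by rewrite bi0 bj0.
Qed.

(** V_1 is now a trivial bundle: it adds d1 = k2 to the rank of U_3, which makes the exponent of det
    Q_2 equal to -d2, but it has no determinant of its own. *)
Lemma crepant_resolution_ii (k2 q : nat) :
  (k2 <= \dim {:V2})%N -> \dim {:V1} = k2 -> \dim {:V3} = (\dim {:V2} - q)%N ->
  crepant (resolution_ii V1 V2 V3 k2 q).
Proof.
move=> k2_le d1 d3.
have n13 : (\dim {:V1} + (\dim {:V2} - k2))%N = \dim {:V2} by rewrite d1 subnKC.
apply: (@crepant_rep C V1 V2 V3 q (\dim {:V1}) (\dim {:V2} - k2)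
  (resolution_ii V1 V2 V3 k2 q)
  (fun i => i.1) (fun i u => vec_mx (lsubmx u))
  (fun i u => vbasis {:V1})
  (fun i u => gr_frame i.2 (vec_mx (rsubmx u)))
  (fun i => gr_vol i.2 ^+ (\dim {:V2} - k2) / gr_vol i.1 ^+ (\dim {:V2} - q))).
- by move=> i a b; apply: (eq_regular _ (regular_coord _ _)) => u; rewrite !mxE.
- by move=> i a; exact: regular_vect_cst.
- move=> i a; apply: gr_frame_regular => {}a b.
  by apply: (eq_regular _ (regular_coord _ _)) => u; rewrite !mxE.
- by move=> i u; exact: basis_free (vbasisP _).
- by move=> i u; exact: gr_free.
- move=> i u; apply/seteqP; split=> phi /=; rewrite (span_basis (vbasisP _)).
    by case=> ? ? ?; split=> //; exact: subvf.
  by case.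
- by move=> i; rewrite !mulf_neq0 ?invr_neq0 ?expf_neq0 ?gr_vol_neq0.
move=> i j u v uv; case: (uv) => uv2 uv3.
(* The frame of V_1 is the same basis in every chart, hence the identity matrix. *)
exists 1%:M, (gr_sub_mx i.2 j.2 (vec_mx (rsubmx u))); split.
- exact: uv2.
- split=> [|a]; first exact: unitmx1.
  rewrite (bigD1 a) //= mxE eqxx scale1r big1 ?addr0 // => l la.
  by rewrite mxE eq_sym (negPf la) scale0r.
- by split=> [|a]; [exact: gr_sub_mx_unit uv3 | exact: gr_frame_trans uv3].
rewrite (canonical_prod _ _ uv); [|exact: sloped_Gr..].
have := gr_canonical_sub uv3; have := gr_canonical_quot uv2.
rewrite /= n13 det1 mul1r (congr1 (GRing.exp _) d3).
have bi0 : gr_vol i.1 ^+ (\dim {:V2} - q) != 0.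
  by rewrite expf_neq0 ?gr_vol_neq0.
have bj0 : gr_vol j.1 ^+ (\dim {:V2} - q) != 0.
  by rewrite expf_neq0 ?gr_vol_neq0.
move=> /(canRL (mulfK bj0))-> <-; field.
by rewrite bi0 bj0.
Qed.

End Resolutions.

Theorem proposition3p12 (R : realType) (V1 V2 V3 : vectType R[i])
    (d1 d2 d3 k1 k2 q1 : nat)
    (dimV1 : \dim {:V1} = d1) (dimV2 : \dim {:V2} = d2)
    (dimV3 : \dim {:V3} = d3)
    (orbit_neq0 : quiver_orbit V1 V2 V3 k1 k2 q1 !=set0) :
  (q1 <> k1 -> q1 <> k2 ->
   d1 = (d2 - q1)%N -> d3 = (d2 - q1)%N -> (k1 + k2)%N = d2 ->
   crepant (resolution_i V1 V2 V3 k1 k2 q1)) /\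
  (q1 = k1 -> d1 = k2 -> d3 = (d2 - k1)%N ->
   crepant (resolution_ii V1 V2 V3 k2 q1)).
Proof.
subst d1 d2 d3; split=> [_ _|->]; first exact: crepant_resolution_i.
(* A point of the orbit gives k2 <= d2, its second kernel being a subspace of V_2. *)
case: orbit_neq0 => phi [_ k2E _].
by apply: crepant_resolution_ii; rewrite -k2E dimvS ?subvf.
Qed.
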